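(* Let $d\ge 3$, let $\mathcal A\in\mathbb R^{n_1\times\cdots\times n_d}$ be a nonzero tensor, and let $0\le\omega_j<1/\sqrt{n_j}$ for $1\le j\le d$. Let $(\mathbf x_1^{\omega_1},\ldots,\mathbf x_d^{\omega_d})$ be any output of Algorithm V2 (described in the context) applied to $(\mathcal A,\omega_1,\ldots,\omega_d)$, and let $A_1\in\mathbb R^{n_1\times\prod_{j=2}^d n_j}$ be the unfolding of $\mathcal A$ formed in Step 1 of that algorithm. Then for every $(\tilde{\mathbf x}_1,\ldots,\tilde{\mathbf x}_d)$ with $\tilde{\mathbf x}_j\in\mathbb R^{n_j}$ and $\|\tilde{\mathbf x}_j\|=1$, $1\le j\le d$, $$\mathcal A\mathbf x_1^{\omega_1}\cdots\mathbf x_d^{\omega_d}\;\ge\; C\,\|\mathcal A\|_F\;\ge\; C\,\lambda_{\max}(A_1)\;\ge\; C\,\mathcal A\tilde{\mathbf x}_1\cdots\tilde{\mathbf x}_d,\qquad\text{where } C=\frac{\prod_{j=1}^d\left(1-\omega_j\sqrt{n_j}+\omega_j\right)}{\sqrt{\prod_{j=1}^{d-1}n_j}} .$$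
   Context: Notation. $\|\cdot\|$ is the Euclidean norm of vectors, $\|\cdot\|_F$ is the Frobenius norm (square root of the sum of squares of all entries), $\lambda_{\max}(\cdot)$ is the largest singular value of a matrix, $\mathbf x(i)$ is the $i$-th entry of $\mathbf x$. For $\mathbf x_j\in\mathbb R^{n_j}$, $\mathcal A\mathbf x_1\cdots\mathbf x_d:=\langle\mathcal A,\mathbf x_1\circ\cdots\circ\mathbf x_d\rangle=\sum_{i_1,\ldots,i_d}\mathcal A(i_1,\ldots,i_d)\,\mathbf x_1(i_1)\cdots\mathbf x_d(i_d)$. Reshape. $\texttt{reshape}$ is the Matlab (column-major) operation: it rearranges the entries of an array into an array of the given size, keeping their order when entries are listed with the first index varying fastest. Thus $\texttt{reshape}(\mathcal A,n_1,\prod_{j=2}^dn_j)$ is the matrix whose row index is $i_1$ and whose column index is the multi-index $(i_2,\ldots,i_d)$ with $i_2$ varying fastest. Sparsification map. For $\mathbf a\in\mathbb R^n$ and $\omega\ge0$, let $S(\mathbf a,\omega)\in\mathbb R^n$ have entries $S(\mathbf a,\omega)(i)=\mathrm{sgn}(\mathbf a(i))\max\{|\mathbf a(i)|-\omega,0\}$. Define $N(\mathbf a,\omega)=S(\mathbf a,\omega)/\|S(\mathbf a,\omega)\|$ if $S(\mathbf a,\omega)\ne0$, and $N(\mathbf a,\omega)=\mathrm{sgn}(\mathbf a(\hat i))\,\mathbf e_{\hat i}$ if $S(\mathbf a,\omega)=0$, where $\hat i$ is any index with $|\mathbf a(\hat i)|=\max_i|\mathbf a(i)|$, $\mathbf e_{\hat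 i}$ is the $\hat i$-th standard basis vector, and in this last formula $\mathrm{sgn}(0)$ is set to $1$. Algorithm V2, with input $\mathcal A\in\mathbb R^{n_1\times\cdots\times n_d}$ and $\omega_1,\ldots,\omega_d\ge0$: Step 1. Let $A_1=\texttt{reshape}(\mathcal A,n_1,\prod_{j=2}^dn_j)$. Let $A_1^{\bar k}$ be a row of $A_1$ of largest Euclidean norm among all rows. Set $\mathbf y_1^*=(A_1^{\bar k})^\top$, $\mathbf x_1^*=A_1\mathbf y_1^*/\|A_1\mathbf y_1^*\|\in\mathbb R^{n_1}$ and $\mathbf x_1^{\omega_1}:=N(\mathbf x_1^*,\omega_1)$. Step 2. For $j=2,\ldots,d-1$: let $A_j=\texttt{reshape}(A_{j-1}^\top\mathbf x_{j-1}^{\omega_{j-1}},n_j,\prod_{k=j+1}^dn_k)\in\mathbb R^{n_j\times\prod_{k=j+1}^dn_k}$. Let $A_j^{\bar k}$ be a row of $A_j$ of largest Euclidean norm. Set $\mathbf y_j^*=(A_j^{\bar k})^\top$, $\mathbf x_j^*=A_j\mathbf y_j^*/\|A_j\mathbf y_j^*\|\in\mathbb R^{n_j}$ and $\mathbf x_j^{\omega_j}:=N(\mathbf x_j^*,\omega_j)$. Step 3. Set $\mathbf x_d^*:=A_{d-1}^\top\mathbf x_{d-1}^{\omega_{d-1}}/\|A_{d-1}^\top\mathbf x_{d-1}^{\omega_{d-1}}\|\in\mathbb R^{n_d}$ and $\mathbf x_d^{\omega_d}:=N(\mathbf x_d^*,\omega_d)$. Step 4. Return $(\mathbf x_1^{\omega_1},\ldots,\mathbf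 x_d^{\omega_d})$. *)

(* Defs.v *)
From HB Require Import structures.
From mathcomp Require Import all_boot all_order all_algebra.
From mathcomp Require Import boolp classical_sets reals.

Set Implicit Arguments.
Unset Strict Implicit.
Unset Printing Implicit Defensive.

Import Order.TTheory GRing.Theory Num.Theory.
Local Open Scope ring_scope.

(* Modes are numbered 0, ..., d-1.  The dimensions are given by n : nat -> nat,
   of which only n 0, ..., n (d-1) matter; likewise for every other family
   indexed by the modes. *)

Definition multi_index (n : nat -> nat) (d : nat) : finType :=
  {dffun forall j : 'I_d, 'I_(n j)}.

Definition tensor (R : realType) (n : nat -> nat) (d : nat) : zmodType :=
  {ffun multi_index n d -> R}.

Definition tensor_norm (R : realType) n d (A : tensor R n d) : R :=
  Num.sqrt (\sum_(i : multi_index n d) A i ^+ 2).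

Definition tensor_form (R : realType) n d (A : tensor R n d)
    (x : forall j : nat, 'cV[R]_(n j)) : R :=
  \sum_(i : multi_index n d) A i * \prod_(j < d) x j (i j) ord0.

(* Frobenius norm, hence the Euclidean norm on row and column vectors (the
   library norm on matrices is the sup norm). *)
Definition mx_norm2 (R : realType) m p (M : 'M[R]_(m, p)) : R :=
  Num.sqrt (\sum_i \sum_k M i k ^+ 2).

Definition normalized (R : realType) p (v : 'cV[R]_p) : 'cV[R]_p :=
  (mx_norm2 v)^-1 *: v.

Definition singular_value (R : realType) m p (M : 'M[R]_(m, p)) (s : R) : Prop :=
  0 <= s /\ eigenvalue (M^T *m M) (s ^+ 2).

(* The set of singular values is finite, so the supremum is a maximum. *)
Definition lambda_max (R : realType) m p (M : 'M[R]_(m, p)) : R :=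
  sup [set s | singular_value M s]%classic.

(* 0-based position of the multi-index i when the first index varies fastest. *)
Definition colmajor_rank n d (i : multi_index n d) : nat :=
  (\sum_(j < d) i j * \prod_(k < j) n k)%N.

Definition tensor_entries (R : realType) n d (A : tensor R n d) : seq R :=
  [seq A i | i <- sort (relpre (@colmajor_rank n d) leq)
                       (enum (multi_index n d))].

Definition vector_entries (R : realType) p (v : 'cV[R]_p) : seq R :=
  [seq v i ord0 | i <- enum 'I_p].

(* Column-major, as in Matlab; the source array is given by its list of
   entries, first index varying fastest. *)
Definition reshape_mx (R : realType) m p (s : seq R) : 'M[R]_(m, p) :=
  \matrix_(i < m, k < p) s`_(i + m * k).

Definition unfolding (R : realType) n d (A : tensor R n d) :
    'M[R]_(n 0%N, \prod_(1 <= k < d) n k) :=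
  reshape_mx _ _ (tensor_entries A).

Definition soft_threshold (R : realType) p (a : 'cV[R]_p) (w : R) : 'cV[R]_p :=
  \col_i (Num.sg (a i ord0) * Num.max (`|a i ord0| - w) 0).

(* b is a possible value of N(a, w); the choice of a maximal index makes N
   multivalued. *)
Definition is_sparsification (R : realType) p (a : 'cV[R]_p) (w : R)
    (b : 'cV[R]_p) : Prop :=
  if soft_threshold a w != 0 then b = normalized (soft_threshold a w)
  else exists i : 'I_p,
    (forall k, `|a k ord0| <= `|a i ord0|) /\
    b = (if a i ord0 == 0 then 1 else Num.sg (a i ord0)) *: delta_mx i ord0.

Definition is_max_row (R : realType) m p (M : 'M[R]_(m, p)) (k : 'I_m) : Prop :=
  forall l, mx_norm2 (row l M) <= mx_norm2 (row k M).

(* M j is the matrix whose rows are searched at mode j, for j < d-1.  At the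
   last mode the reshape to an (n (d-1)) x 1 array leaves the vector unchanged:
   it only identifies its length \prod_(d-1 <= k < d) n k with n (d-1). *)
Definition algorithm_V2_run (R : realType) n d (A : tensor R n d)
    (w : nat -> R) (M : forall j : nat, 'M[R]_(n j, \prod_(j.+1 <= k < d) n k))
    (x : forall j : nat, 'cV[R]_(n j)) : Prop :=
  [/\ M 0%N = unfolding A,
      forall j : nat, (j.+2 < d)%N ->
        M j.+1 = reshape_mx _ _ (vector_entries ((M j)^T *m x j)),
      forall j : nat, (j.+1 < d)%N ->
        exists k : 'I_(n j), is_max_row (M j) k /\
          is_sparsification (normalized (M j *m (row k (M j))^T)) (w j) (x j)
    & forall j : nat, j.+2 = d ->
        is_sparsification
          (normalized
             (reshape_mx (n j.+1) 1 (vector_entries ((M j)^T *m x j))))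
          (w j.+1) (x j.+1)].

Definition algorithm_V2_output (R : realType) n d (A : tensor R n d)
    (w : nat -> R) (x : forall j : nat, 'cV[R]_(n j)) : Prop :=
  exists M, algorithm_V2_run A w M x.

(* Main.v *)
(* If a is a unit vector and b = N(a, w) with w < 1/sqrt p, then s = S(a, w)
   satisfies <a, s> = |s|^2 + w |s|_1 and |a - s| <= w sqrt p, whence
   <a, b> >= |s| + w >= 1 - w sqrt p + w.  With y the longest row of M_j,
   <M_j^T x_j, y> = <x_j, M_j y> >= (1 - w_j sqrt n_j + w_j) |M_j y|, and
   |M_j y| >= |y|^2 >= |y| |M_j|_F / sqrt n_j; by Cauchy-Schwarz
   |M_j^T x_j| >= (1 - w_j sqrt n_j + w_j) |M_j|_F / sqrt n_j.  Reshaping keeps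
   the Frobenius norm, so these factors multiply up, and the last mode
   contributes its sparsification factor only.  Contracting the modes one after
   the other through the reshapes gives the multilinear form because the
   column-major rank is a mixed-radix expansion of the multi-index. *)

Require Import Defs.
From HB Require Import structures.
From mathcomp Require Import all_boot all_order all_algebra.
From mathcomp Require Import boolp classical_sets reals.
From mathcomp Require Import ring lra zify.
Import Order.TTheory GRing.Theory Num.Theory.
Local Open Scope ring_scope.

Set Implicit Arguments.
Unset Strict Implicit.
Unset Printing Implicit Defensive.

(** * Frobenius inner product, norms and Cauchy-Schwarz *)

(** For [c > 0] the minimiser [t = - b / c] gives the value [a - b^2 / c]. If [c = 0] the polynomial
    is affine in [t], and [b != 0] would let it take the value [-1]. *)
Lemma quadratic_discriminant (R : realType) (a b c : R) :
  0 <= c -> (forall t, 0 <= a + 2 * (t * b) + t ^+ 2 * c) -> b ^+ 2 <= a * c.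
Proof.
move=> c0 H; have [ce0|cn0] := eqVneq c 0.
  rewrite ce0 mulr0; have [->|b0] := eqVneq b 0; first by rewrite expr0n.
  have := H (- (a + 1) / (2 * b)); rewrite ce0.
  by rewrite (_ : _ + _ = -1) ?ler0N1//; field.
have cp : 0 < c by rewrite lt_neqAle eq_sym cn0.
have := H (- b / c).
rewrite (_ : _ + _ = (a * c - b ^+ 2) / c); last by field.
by rewrite pmulr_lge0 ?invr_gt0// subr_ge0.
Qed.

(** The Frobenius inner product, written as a trace so that bilinearity and adjunction come from
    matrix algebra. *)
Definition dot (R : realType) m p (u v : 'M[R]_(m, p)) : R := \tr (u^T *m v).

Lemma dotE (R : realType) m p (u v : 'M[R]_(m, p)) :
  dot u v = \sum_i \sum_k u i k * v i k.
Proof.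
rewrite /dot /mxtrace exchange_big /=; apply: eq_bigr => k _.
by rewrite mxE; apply: eq_bigr => i _; rewrite mxE.
Qed.

Lemma dotvE (R : realType) p (u v : 'cV[R]_p) :
  dot u v = \sum_i u i ord0 * v i ord0.
Proof. by rewrite dotE; apply: eq_bigr => i _; rewrite big_ord1. Qed.

Lemma dotC (R : realType) m p (u v : 'M[R]_(m, p)) : dot u v = dot v u.
Proof. by rewrite /dot -mxtrace_tr trmx_mul trmxK. Qed.

Lemma dotZr (R : realType) m p a (u v : 'M[R]_(m, p)) :
  dot u (a *: v) = a * dot u v.
Proof. by rewrite /dot -scalemxAr mxtraceZ. Qed.

Lemma dotZl (R : realType) m p a (u v : 'M[R]_(m, p)) :
  dot (a *: u) v = a * dot u v.
Proof. by rewrite dotC dotZr dotC. Qed.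

Lemma dotDr (R : realType) m p (u v w : 'M[R]_(m, p)) :
  dot u (v + w) = dot u v + dot u w.
Proof. by rewrite /dot mulmxDr mxtraceD. Qed.

Lemma dotDl (R : realType) m p (u v w : 'M[R]_(m, p)) :
  dot (v + w) u = dot v u + dot w u.
Proof. by rewrite dotC dotDr !(dotC u). Qed.

Lemma dot_mull (R : realType) m p q (M : 'M[R]_(m, p)) (u : 'M_(m, q)) v :
  dot (M^T *m u) v = dot u (M *m v).
Proof. by rewrite /dot trmx_mul trmxK mulmxA. Qed.

Lemma dot_ge0 (R : realType) m p (u : 'M[R]_(m, p)) : 0 <= dot u u.
Proof.
rewrite dotE; apply: sumr_ge0 => i _; apply: sumr_ge0 => k _.
by rewrite -expr2 sqr_ge0.
Qed.

Lemma dot_eq0 (R : realType) m p (u : 'M[R]_(m, p)) : (dot u u == 0) = (u == 0).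
Proof.
apply/eqP/eqP => [|->]; last by rewrite /dot mulmx0 mxtrace0.
rewrite dotE => /eqP.
have H i : 0 <= \sum_k u i k * u i k.
  by apply: sumr_ge0 => k _; rewrite -expr2 sqr_ge0.
rewrite psumr_eq0// => /allP ui; apply/matrixP => i k; rewrite mxE.
have /eqP := ui i (mem_index_enum _).
move=> /eqP; rewrite psumr_eq0 => [|j _]; last by rewrite -expr2 sqr_ge0.
by move=> /allP /(_ k (mem_index_enum _)); rewrite -expr2 sqrf_eq0 => /eqP.
Qed.

Lemma mx_norm2_ge0 (R : realType) m p (u : 'M[R]_(m, p)) : 0 <= mx_norm2 u.
Proof. exact: sqrtr_ge0. Qed.

Lemma sqr_mx_norm2 (R : realType) m p (u : 'M[R]_(m, p)) :
  mx_norm2 u ^+ 2 = dot u u.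
Proof.
rewrite /mx_norm2.
have -> : \sum_i \sum_k u i k ^+ 2 = dot u u by rewrite dotE.
by rewrite sqr_sqrtr ?dot_ge0.
Qed.

Lemma mx_norm2_gt0 (R : realType) m p (u : 'M[R]_(m, p)) :
  (0 < mx_norm2 u) = (u != 0).
Proof.
by rewrite -dot_eq0 -sqr_mx_norm2 sqrf_eq0 lt_neqAle mx_norm2_ge0 andbT eq_sym.
Qed.

(** The form at [u + t *: v] is a nonnegative quadratic polynomial in [t]. It is applied below to
    the form of [mu - M^T M]. *)
Lemma cauchy_schwarz_psd (R : realType) p (B : 'M[R]_p) :
  B^T = B -> (forall v : 'cV_p, 0 <= dot v (B *m v)) ->
  forall u v : 'cV_p, dot u (B *m v) ^+ 2 <= dot u (B *m u) * dot v (B *m v).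
Proof.
move=> Bsym Bpos u v; apply: quadratic_discriminant => [|t]; first exact: Bpos.
have Bvu : dot v (B *m u) = dot u (B *m v) by rewrite -dot_mull Bsym dotC.
have := Bpos (u + t *: v).
rewrite mulmxDr -scalemxAr !dotDl !dotDr !dotZl !dotZr Bvu.
by congr (_ <= _); ring.
Qed.

Lemma cauchy_schwarz_sqr (R : realType) m p (u v : 'M[R]_(m, p)) :
  dot u v ^+ 2 <= dot u u * dot v v.
Proof.
apply: quadratic_discriminant => [|t]; first exact: dot_ge0.
have := dot_ge0 (u + t *: v); rewrite !dotDl !dotDr !dotZl !dotZr (dotC v u).
by congr (_ <= _); ring.
Qed.

Lemma cauchy_schwarz (R : realType) m p (u v : 'M[R]_(m, p)) :
  dot u v <= mx_norm2 u * mx_norm2 v.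
Proof.
apply: le_trans (ler_norm _) _.
rewrite -ler_sqr ?nnegrE ?mulr_ge0 ?mx_norm2_ge0// exprMn !sqr_mx_norm2.
by rewrite real_normK ?num_real// cauchy_schwarz_sqr.
Qed.

Lemma mx_norm2D (R : realType) m p (u v : 'M[R]_(m, p)) :
  mx_norm2 (u + v) <= mx_norm2 u + mx_norm2 v.
Proof.
rewrite -ler_sqr ?nnegrE ?addr_ge0 ?mx_norm2_ge0// sqrrD !sqr_mx_norm2.
rewrite !dotDl !dotDr (dotC v u) -mulr_natl.
have := cauchy_schwarz u v. nra.
Qed.

Lemma mx_norm2Z (R : realType) m p a (u : 'M[R]_(m, p)) :
  0 <= a -> mx_norm2 (a *: u) = a * mx_norm2 u.
Proof.
move=> a0; apply/eqP.
rewrite -(@eqrXn2 _ 2) ?mulr_ge0 ?mx_norm2_ge0//.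
by rewrite exprMn !sqr_mx_norm2 dotZl dotZr mulrA.
Qed.

Lemma mx_norm2_normalized (R : realType) p (v : 'cV[R]_p) :
  v != 0 -> mx_norm2 (normalized v) = 1.
Proof.
move=> v0; rewrite mx_norm2Z ?invr_ge0 ?mx_norm2_ge0// mulVf//.
by rewrite gt_eqF ?mx_norm2_gt0.
Qed.

Lemma sqr_mx_norm2_rows (R : realType) m p (M : 'M[R]_(m, p)) :
  mx_norm2 M ^+ 2 = \sum_i mx_norm2 (row i M) ^+ 2.
Proof.
rewrite sqr_mx_norm2 dotE; apply: eq_bigr => i _.
rewrite sqr_mx_norm2 dotE big_ord1.
by apply: eq_bigr => k _; rewrite mxE.
Qed.

Lemma mulmx_rowE (R : realType) m p (M : 'M[R]_(m, p)) (v : 'cV_p) i :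
  (M *m v) i ord0 = dot (row i M)^T v.
Proof. by rewrite dotvE mxE; apply: eq_bigr => k _; rewrite !mxE. Qed.

Lemma mx_norm2_tr (R : realType) m p (M : 'M[R]_(m, p)) :
  mx_norm2 M^T = mx_norm2 M.
Proof.
apply/eqP; rewrite -(@eqrXn2 _ 2) ?mx_norm2_ge0// !sqr_mx_norm2.
by rewrite /dot trmxK mxtrace_mulC.
Qed.

(** Cauchy-Schwarz on each row, summed over the rows. *)
Lemma mx_norm2_mulmx_le (R : realType) m p (M : 'M[R]_(m, p)) (v : 'cV_p) :
  mx_norm2 (M *m v) <= mx_norm2 M * mx_norm2 v.
Proof.
rewrite -ler_sqr ?nnegrE ?mulr_ge0 ?mx_norm2_ge0// exprMn.
rewrite sqr_mx_norm2 dotvE sqr_mx_norm2_rows mulr_suml; apply: ler_sum => i _.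
rewrite mulmx_rowE -expr2 -(mx_norm2_tr (row i M)) !sqr_mx_norm2.
exact: cauchy_schwarz_sqr.
Qed.

(** * Soft thresholding and sparsification *)

(** Both sides vanish if [|a| <= w]; otherwise [a] and [s] share their sign and [|a| = |s| + w]. *)
Lemma soft_threshold_mul (R : realType) (a w : R) :
  0 <= w ->
  let s := Num.sg a * Num.max (`|a| - w) 0 in a * s = s ^+ 2 + w * `|s|.
Proof.
move=> w0 /=; rewrite maxEle subr_le0.
have [_|wa] := leP `|a| w; first by rewrite mulr0 normr0 !mulr0 expr0n addr0.
have a0 : a != 0 by rewrite -normr_eq0 gt_eqF// (le_lt_trans w0).
rewrite normrM normr_sg a0 mul1r [X in w * X]gtr0_norm ?subr_gt0//.
rewrite exprMn sqr_sg a0 mul1r mulrA [a * _]mulrC -normrEsg; ring.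
Qed.

(** Thresholding moves [a] by exactly [min(|a|, w)]. *)
Lemma soft_threshold_dist (R : realType) (a w : R) :
  0 <= w -> (a - Num.sg a * Num.max (`|a| - w) 0) ^+ 2 <= w ^+ 2.
Proof.
move=> w0; rewrite maxEle subr_le0.
have [aw|wa] := leP `|a| w.
  by rewrite mulr0 subr0 -real_normK ?num_real// ler_sqr ?nnegrE.
have a0 : a != 0 by rewrite -normr_eq0 gt_eqF// (le_lt_trans w0).
by rewrite {1}[a]numEsg -mulrBr exprMn sqr_sg a0 mul1r opprB addrC subrK.
Qed.

(** Division by zero gives 0, so the bounds on [w] rule out [p = 0]. *)
Lemma sqrt_size_gt0 (R : realType) (w : R) p :
  0 <= w < 1 / Num.sqrt p%:R -> 0 < Num.sqrt p%:R :> R.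
Proof.
by move=> /andP[w0 wp]; rewrite -invr_gt0 -div1r; apply: le_lt_trans wp.
Qed.

Lemma soft_threshold_norm_ge (R : realType) p (a : 'cV[R]_p) w :
  mx_norm2 a = 1 -> 0 <= w < 1 / Num.sqrt p%:R ->
  1 - w * Num.sqrt p%:R <= mx_norm2 (soft_threshold a w)
  /\ 0 < 1 - w * Num.sqrt p%:R.
Proof.
move=> a1 hw; have p0 := sqrt_size_gt0 hw; have /andP[w0 wp] := hw.
split; last by rewrite subr_gt0 -ltr_pdivlMr.
rewrite lerBlDr -{1}a1 -[a in leLHS](subrK (soft_threshold a w)) addrC.
apply: le_trans (mx_norm2D _ _) _; rewrite lerD2l.
rewrite -ler_sqr ?nnegrE ?mulr_ge0 ?mx_norm2_ge0//; last exact: ltW.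
rewrite sqr_mx_norm2 dotvE exprMn sqr_sqrtr ?ler0n//.
apply: le_trans (_ : \sum_(i < p) w ^+ 2 <= _).
  by apply: ler_sum => i _; rewrite -expr2 !mxE soft_threshold_dist.
by rewrite sumr_const card_ord mulr_natr.
Qed.

Lemma mx_norm2_le_sum (R : realType) p (s : 'cV[R]_p) :
  mx_norm2 s <= \sum_i `|s i ord0|.
Proof.
have S0 : 0 <= \sum_i `|s i ord0| by apply: sumr_ge0.
rewrite -ler_sqr ?nnegrE ?mx_norm2_ge0// sqr_mx_norm2 dotvE expr2 mulr_suml.
apply: ler_sum => i _; rewrite -expr2 -real_normK ?num_real// expr2.
by apply: ler_wpM2l => //; rewrite (bigD1 i)//= lerDl sumr_ge0.
Qed.

Lemma sparsification_dot (R : realType) p (a b : 'cV[R]_p) w :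
  mx_norm2 a = 1 -> 0 <= w < 1 / Num.sqrt p%:R -> is_sparsification a w b ->
  1 - w * Num.sqrt p%:R + w <= dot a b.
Proof.
move=> a1 hw; have [sge sp] := soft_threshold_norm_ge a1 hw.
have {hw}w0 : 0 <= w by case/andP: hw.
rewrite /is_sparsification; set s := soft_threshold a w in sge *.
have s0 : 0 < mx_norm2 s by apply: lt_le_trans sge.
(* Since [s] is nonzero, only the normalizing branch of N can occur. *)
rewrite -mx_norm2_gt0 s0 => ->.
have as_ : dot a s = mx_norm2 s ^+ 2 + w * \sum_i `|s i ord0|.
  rewrite sqr_mx_norm2 !dotvE mulr_sumr -big_split /=; apply: eq_bigr => i _.
  by rewrite !mxE -expr2 soft_threshold_mul.
rewrite dotZr as_ [leRHS]mulrC ler_pdivlMr//.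
(* After multiplication by [|s|], the bound follows from [|s| >= 1 - w sqrt p] and
   [|s|_1 >= |s|]. *)
have := mx_norm2_le_sum s => h.
have := ler_wpM2l w0 h; nra.
Qed.

(** * Norm bound for the contraction of one mode *)

Definition mode_factor (R : realType) (w : R) (p : nat) : R :=
  1 - w * Num.sqrt p%:R + w.

Lemma mode_factor_gt0 (R : realType) (w : R) p :
  0 <= w < 1 / Num.sqrt p%:R -> 0 < mode_factor w p.
Proof.
move=> hw; have /andP[w0 wp] := hw.
by rewrite ltr_pwDl// subr_gt0 -ltr_pdivlMr// (sqrt_size_gt0 hw).
Qed.

Lemma sparsification_normalized_dot (R : realType) p (v b : 'cV[R]_p) w :
  v != 0 -> 0 <= w < 1 / Num.sqrt p%:R ->
  is_sparsification (normalized v) w b ->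
  mode_factor w p * mx_norm2 v <= dot v b.
Proof.
move=> v0 hw hb; have v0' : 0 < mx_norm2 v by rewrite mx_norm2_gt0.
have := sparsification_dot (mx_norm2_normalized v0) hw hb.
by rewrite dotZl ler_pdivlMl// mulrC.
Qed.

Lemma max_row_step (R : realType) m p (M : 'M[R]_(m, p)) k (x : 'cV_m) w :
  M != 0 -> is_max_row M k -> 0 <= w < 1 / Num.sqrt m%:R ->
  is_sparsification (normalized (M *m (row k M)^T)) w x ->
  mode_factor w m / Num.sqrt m%:R * mx_norm2 M <= mx_norm2 (M^T *m x).
Proof.
move=> M0 kmax hw hx; set y := (row k M)^T in hx.
have m0 := sqrt_size_gt0 hw.
(* The squared norm of [M] is a sum of [m] squared row norms, each at most that of [y]. *)
have My : mx_norm2 M <= Num.sqrt m%:R * mx_norm2 y.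
  rewrite -ler_sqr ?nnegrE ?mulr_ge0 ?mx_norm2_ge0//; last exact: ltW.
  rewrite sqr_mx_norm2_rows exprMn [in leRHS]sqr_sqrtr ?ler0n//.
  apply: le_trans (_ : \sum_(i < m) mx_norm2 y ^+ 2 <= _).
    apply: ler_sum => i _; rewrite ler_sqr ?nnegrE ?mx_norm2_ge0//.
    by rewrite mx_norm2_tr.
  by rewrite sumr_const card_ord mulr_natl.
have y0 : 0 < mx_norm2 y.
  by rewrite -(pmulr_rgt0 _ m0); apply: lt_le_trans My; rewrite mx_norm2_gt0.
(* Entry [k] of [M *m y] is [|y|^2], because [y] is row [k]. *)
have yM : mx_norm2 y ^+ 2 <= mx_norm2 (M *m y).
  rewrite sqr_mx_norm2 -mulmx_rowE -/y.
  rewrite -ler_sqr ?nnegrE ?mx_norm2_ge0//.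
    rewrite sqr_mx_norm2 dotvE (bigD1 k)//= -expr2 lerDl.
    by apply: sumr_ge0 => i _; rewrite -expr2 sqr_ge0.
  by rewrite mulmx_rowE dot_ge0.
have y20 : 0 < mx_norm2 y ^+ 2 by rewrite exprn_gt0.
have My0 : M *m y != 0 by rewrite -mx_norm2_gt0; apply: lt_le_trans yM.
have c0 := mode_factor_gt0 hw.
have h1 := sparsification_normalized_dot My0 hw hx.
have h2 := cauchy_schwarz (M^T *m x) y.
rewrite dot_mull dotC in h2.
(* One factor [|y|] is cancelled from the chain [h1], [h2]. *)
have h3 : mode_factor w m * mx_norm2 y <= mx_norm2 (M^T *m x).
  rewrite -(ler_pM2r y0) -mulrA -expr2.
  apply: le_trans h2; apply: le_trans h1; rewrite ler_wpM2l//; exact: ltW.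
apply: le_trans h3; rewrite -mulrA ler_wpM2l//; first exact: ltW.
by rewrite mulrC ler_pdivrMr// mulrC.
Qed.

(** * Singular values *)

(** [eigenvalue] provides a row eigenvector [v]; by symmetry of [M^T M] its transpose is a column
    eigenvector, whence [|M v^T| = s |v|], which is at most [|M| |v|]. *)
Lemma singular_value_le_norm (R : realType) m p (M : 'M[R]_(m, p)) s :
  singular_value M s -> s <= mx_norm2 M.
Proof.
move=> [s0 /eigenvalueP[v vE v0]].
have v0' : 0 < mx_norm2 v^T by rewrite mx_norm2_tr mx_norm2_gt0.
have Mv : mx_norm2 (M *m v^T) = s * mx_norm2 v^T.
  apply/eqP; rewrite -(@eqrXn2 _ 2) ?mulr_ge0 ?mx_norm2_ge0//.
  rewrite exprMn !sqr_mx_norm2 -dot_mull mulmxA.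
  have -> : M^T *m M *m v^T = s ^+ 2 *: v^T.
    by rewrite -[RHS]linearZ /= -vE !trmx_mul trmxK.
  by rewrite dotZl.
by rewrite -(ler_pM2r v0') -Mv mx_norm2_mulmx_le.
Qed.

(* The supremum mu of |M z|^2 over unit vectors z is an eigenvalue of M^T M:
   otherwise B = mu - M^T M is positive and invertible, and Cauchy-Schwarz for
   the form B applied to z and B^-1 z gives <z, B z> >= 1 / |B^-1| for every
   unit z, so mu would not be the least upper bound. *)
Lemma exists_singular_value_ge (R : realType) m p (M : 'M[R]_(m, p))
    (z : 'cV_p) : mx_norm2 z = 1 ->
  exists2 s, singular_value M s & mx_norm2 (M *m z) <= s.
Proof.
move=> z1.
pose E := [set t : R | exists2 v : 'cV[R]_p,
                         mx_norm2 v = 1 & t = mx_norm2 (M *m v) ^+ 2]%classic.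
have Ez : E (mx_norm2 (M *m z) ^+ 2) by exists z.
have E0 : (E !=set0)%classic by exists (mx_norm2 (M *m z) ^+ 2).
have ubE : has_ubound E.
  exists (mx_norm2 M ^+ 2) => _ [v v1 ->].
  rewrite ler_sqr ?nnegrE ?mx_norm2_ge0//.
  by apply: le_trans (mx_norm2_mulmx_le _ _) _; rewrite v1 mulr1.
set mu := sup E.
have mu_ge (v : 'cV_p) : mx_norm2 v = 1 -> mx_norm2 (M *m v) ^+ 2 <= mu.
  by move=> v1; apply: ub_le_sup => //; exists v.
have mu0 : 0 <= mu by apply: le_trans (mu_ge z z1); rewrite sqr_ge0.
suff Emu : eigenvalue (M^T *m M) mu.
  exists (Num.sqrt mu); first by split; rewrite ?sqrtr_ge0 ?sqr_sqrtr.
  by rewrite -ler_sqr ?nnegrE ?mx_norm2_ge0 ?sqrtr_ge0// [in leRHS]sqr_sqrtr// mu_ge.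
pose B := mu%:M - M^T *m M.
have BE (v : 'cV_p) : dot v (B *m v) = mu * dot v v - mx_norm2 (M *m v) ^+ 2.
  rewrite mulmxBl mul_scalar_mx -scaleN1r dotDr !dotZr mulN1r -mulmxA.
  by rewrite sqr_mx_norm2 [dot v (M^T *m _)]dotC dot_mull.
have Bsym : B^T = B.
  by rewrite linearB /= tr_scalar_mx trmx_mul trmxK.
have Bpos (v : 'cV_p) : 0 <= dot v (B *m v).
  have [->|v0] := eqVneq v 0; first by rewrite mulmx0 /dot mulmx0 mxtrace0.
  have vp : 0 < mx_norm2 v by rewrite mx_norm2_gt0.
  have := mu_ge _ (mx_norm2_normalized v0).
  rewrite -scalemxAr mx_norm2Z ?invr_ge0 ?mx_norm2_ge0// exprMn exprVn.
  by rewrite ler_pdivrMl ?exprn_gt0// BE -sqr_mx_norm2 subr_ge0 mulrC.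
(* [eigenvalue] means that [M^T M - mu] has a nonzero kernel; its failure makes this matrix, hence
   its opposite [B], invertible. *)
apply/negP; rewrite kermx_eq0 row_free_unit => gU.
have BU : B \in unitmx.
  by rewrite /B -opprB -scaleN1r unitmxZ// unitrN1.
set K := mx_norm2 (invmx B).
have key (v : 'cV_p) : mx_norm2 v = 1 -> 1 <= dot v (B *m v) * K.
  move=> v1; have := cauchy_schwarz_psd Bsym Bpos v (invmx B *m v).
  rewrite mulKVmx// -[in leLHS]sqr_mx_norm2 v1 !expr1n => /le_trans; apply.
  apply: ler_wpM2l => //; apply: le_trans (cauchy_schwarz _ _) _.
  by rewrite v1 mulr1; apply: le_trans (mx_norm2_mulmx_le _ _) _; rewrite v1 mulr1.
have K0 : 0 < K.
  rewrite lt_neqAle mx_norm2_ge0 andbT; apply/eqP => K0.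
  by have := key z z1; rewrite -K0 mulr0 ler10.
suff : mu <= mu - K^-1 by rewrite lerBrDl gerDr leNgt invr_gt0 K0.
apply: ge_sup => // _ [v v1 ->].
have := key v v1; rewrite BE -sqr_mx_norm2 v1 expr1n mulr1 -ler_pdivrMr// div1r.
lra.
Qed.

Lemma lambda_max_le_norm (R : realType) m p (M : 'M[R]_(m, p)) :
  lambda_max M <= mx_norm2 M.
Proof.
have [E0|E0] := pselect ([set s | singular_value M s] !=set0)%classic.
  by apply: ge_sup => // s; apply: singular_value_le_norm.
(* Without any singular value the supremum takes its default value 0. *)
by rewrite /lambda_max sup_out ?mx_norm2_ge0// => -[].
Qed.

Lemma mx_norm2_mulmx_le_lambda_max (R : realType) m p (M : 'M[R]_(m, p))
    (z : 'cV_p) : mx_norm2 z = 1 -> mx_norm2 (M *m z) <= lambda_max M.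
Proof.
move=> z1; have [s sM /le_trans] := exists_singular_value_ge M z1; apply.
apply: ub_le_sup => //; exists (mx_norm2 M) => t.
exact: singular_value_le_norm.
Qed.

(** * Column-major reshaping *)

(** Induction on [p]: the last column occupies the last [m] positions. *)
Lemma sum_reshape (V : nmodType) m p (g : nat -> V) :
  \sum_(i < m) \sum_(k < p) g (i + m * k)%N = \sum_(r < m * p) g r.
Proof.
rewrite exchange_big /=; elim: p => [|p IH]; first by rewrite muln0 !big_ord0.
rewrite big_ord_recr mulnSr big_split_ord /= IH; congr (_ + _).
by apply: eq_bigr => i _; rewrite addnC.
Qed.

Lemma vector_entriesE (R : realType) p (v : 'cV[R]_p) (i : 'I_p) :
  (vector_entries v)`_i = v i ord0.
Proof.
by rewrite (nth_map i) ?size_enum_ord ?ltn_ord// nth_ord_enum.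
Qed.

Lemma sqr_norm_reshape (R : realType) m p (s : seq R) :
  mx_norm2 (reshape_mx m p s) ^+ 2 = \sum_(r < m * p) s`_r ^+ 2.
Proof.
rewrite sqr_mx_norm2 dotE -(sum_reshape _ _ (fun r => s`_r ^+ 2)).
by apply: eq_bigr => i _; apply: eq_bigr => k _; rewrite !mxE expr2.
Qed.

(** Both norms sum the squares of the same list of entries. The sizes are related by an equation
    because products of dimensions agree only propositionally. *)
Lemma norm_reshape_vector (R : realType) m p q (v : 'cV[R]_q) :
  q = (m * p)%N -> mx_norm2 (reshape_mx m p (vector_entries v)) = mx_norm2 v.
Proof.
move=> qE; apply/eqP; rewrite -(@eqrXn2 _ 2) ?mx_norm2_ge0//.
rewrite sqr_norm_reshape -qE sqr_mx_norm2 dotvE; apply/eqP/eq_bigr => i _.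
by rewrite vector_entriesE expr2.
Qed.

(** Position [r = i + m k] has remainder [i] and quotient [k], so summing over [i] contracts the row
    mode against [x]. This peels one mode off the multilinear form. *)
Lemma reshape_contract (R : realType) m p (s : seq R) (x : 'cV[R]_m)
    (u : nat -> R) :
  \sum_(r < m * p) s`_r * ((vector_entries x)`_(r %% m) * u (r %/ m)%N) =
  \sum_(k < p) ((reshape_mx m p s)^T *m x) k ord0 * u k.
Proof.
rewrite -(sum_reshape m p (fun r =>
  s`_r * ((vector_entries x)`_(r %% m) * u (r %/ m)%N))) exchange_big /=.
apply: eq_bigr => k _; rewrite mxE mulr_suml; apply: eq_bigr => i _.
have m0 : (0 < m)%N by apply: leq_ltn_trans (ltn_ord i).
rewrite !mxE addnC mulnC modnMDl divnMDl// modn_small// divn_small// addn0.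
by rewrite vector_entriesE mulrA.
Qed.

(** * Mixed-radix expansions *)

(* [weight n X m j r] is the product of the X i at the mixed-radix digits, in
   the bases n j, n j.+1, ..., of r. *)
Fixpoint weight (R : realType) (n : nat -> nat) (X : nat -> nat -> R)
    (m j r : nat) : R :=
  if m is m'.+1 then X j (r %% n j)%N * weight n X m' j.+1 (r %/ n j)%N else 1.

(** Horner form of the number with digits [c j], [c j.+1], ..., least significant first, in the
    bases [n j], [n j.+1], ...; it recurses in step with [weight]. *)
Fixpoint mixed_value (n c : nat -> nat) (m j : nat) : nat :=
  if m is m'.+1 then (c j + n j * mixed_value n c m' j.+1)%N else 0%N.

Lemma prod_nat_ltn (n : nat -> nat) m j :
  (\prod_(j <= k < j + m.+1) n k = n j * \prod_(j.+1 <= k < j.+1 + m) n k)%N.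
Proof. by rewrite big_ltn ?addSnnS// -addSnnS leq_addr. Qed.

Lemma mixed_valueE n c m j :
  mixed_value n c m j = (\sum_(i < m) c (j + i) * \prod_(k < i) n (j + k))%N.
Proof.
elim: m j => [|m IH] j /=; first by rewrite big_ord0.
rewrite big_ord_recl IH addn0 big_ord0 muln1; congr addn.
rewrite big_distrr /=; apply: eq_bigr => i _.
rewrite big_ord_recl addn0 /bump /= addSnnS mulnCA; congr (_ * (_ * _))%N.
by apply: eq_bigr => k _; rewrite addSnnS.
Qed.

Lemma mixed_value_lt n c m j :
  (forall i, (j <= i < j + m)%N -> (c i < n i)%N) ->
  (mixed_value n c m j < \prod_(j <= k < j + m) n k)%N.
Proof.
elim: m j => [|m IH] j H /=; first by rewrite addn0 big_geq.
rewrite prod_nat_ltn.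
have lt_m := IH j.+1 (fun i ij => H i ltac:(lia)).
have cj : (c j < n j)%N by apply: H; lia.
by nia.
Qed.

(** Remainder and quotient by [n j] recover the lowest digit and the value of the others. *)
Lemma mixed_value_inj n c c' m j :
  (forall i, (j <= i < j + m)%N -> (c i < n i)%N) ->
  (forall i, (j <= i < j + m)%N -> (c' i < n i)%N) ->
  mixed_value n c m j = mixed_value n c' m j ->
  forall i, (j <= i < j + m)%N -> c i = c' i.
Proof.
elim: m j => [|m IH] j Hc Hc' /=; first by move=> _ i; lia.
have jj : (j <= j < j + m.+1)%N by lia.
have cj := Hc j jj; have cj' := Hc' j jj.
have n0 : (0 < n j)%N by lia.
move=> E; have Emod := congr1 (modn^~ (n j)) E.
have Ediv := congr1 (divn^~ (n j)) E.
rewrite /= !(addnC (_ j)) ![(n j * _)%N]mulnC !modnMDl !modn_small// in Emod.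
rewrite /= !(addnC (_ j)) ![(n j * _)%N]mulnC !divnMDl// !divn_small// !addn0 in Ediv.
move=> i ij; have [<-//|ne] := eqVneq j i.
by apply: (IH j.+1) => //; [move=> l ?; apply: Hc|move=> l ?; apply: Hc'|]; lia.
Qed.

Lemma weight_mixed_value (R : realType) n (X : nat -> nat -> R) c m j :
  (forall i, (j <= i < j + m)%N -> (c i < n i)%N) ->
  weight n X m j (mixed_value n c m j) = \prod_(j <= i < j + m) X i (c i).
Proof.
elim: m j => [|m IH] j H /=; first by rewrite addn0 big_geq.
have cj : (c j < n j)%N by apply: H; lia.
have n0 : (0 < n j)%N by lia.
rewrite addnC mulnC modnMDl divnMDl// modn_small// divn_small// addn0.
rewrite IH; last by move=> i ?; apply: H; lia.
by rewrite [RHS]big_ltn ?addSnnS//; lia.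
Qed.

(** The weights are the entries of an outer product of vectors, whose squared norm factors; each
    induction step splits off the lowest digit. *)
Lemma sum_weight_sqr (R : realType) n (X : nat -> nat -> R) m j :
  \sum_(r < \prod_(j <= k < j + m) n k) weight n X m j r ^+ 2 =
  \prod_(j <= i < j + m) \sum_(k < n i) X i k ^+ 2.
Proof.
elim: m j => [|m IH] j.
  by rewrite !addn0 !big_geq// big_ord1 expr1n.
rewrite prod_nat_ltn -(sum_reshape _ _ (fun r => weight n X m.+1 j r ^+ 2)).
rewrite [RHS]big_ltn -?addSnnS ?leq_addr// -IH mulr_suml.
apply: eq_bigr => i _; rewrite mulr_sumr; apply: eq_bigr => k _ /=.
have n0 : (0 < n j)%N by apply: leq_ltn_trans (ltn_ord i).
by rewrite addnC mulnC modnMDl divnMDl// modn_small// divn_small// addn0 exprMn.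
Qed.

(** * Tensor entries listed by column-major rank *)

(** The multi-index is extended by 0 to all naturals, as [mixed_value] expects. *)
Definition digit n d (i : multi_index n d) (j : nat) : nat :=
  oapp (fun k : 'I_d => nat_of_ord (i k)) 0%N (insub j).

Lemma digitE n d (i : multi_index n d) (j : 'I_d) : digit i j = i j.
Proof. by rewrite /digit valK. Qed.

Lemma digit_lt n d (i : multi_index n d) j :
  (0 <= j < 0 + d)%N -> (digit i j < n j)%N.
Proof.
rewrite add0n => /= jd.
by rewrite -[j]/(nat_of_ord (Ordinal jd)) digitE.
Qed.

Lemma colmajor_rankE n d (i : multi_index n d) :
  colmajor_rank i = mixed_value n (digit i) d 0.
Proof.
rewrite mixed_valueE; apply: eq_bigr => j _; rewrite add0n digitE.
by congr muln.
Qed.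

Lemma colmajor_rank_inj n d : injective (@colmajor_rank n d).
Proof.
move=> i i'; rewrite !colmajor_rankE => E; apply/ffunP => j; apply: val_inj.
rewrite /= -!digitE.
apply: (mixed_value_inj (@digit_lt _ _ i) (@digit_lt _ _ i') E).
by rewrite add0n ltn_ord.
Qed.

Lemma card_multi_index n d :
  #|{: multi_index n d}| = (\prod_(0 <= k < d) n k)%N.
Proof.
rewrite card_dep_ffun foldrE big_map big_enum big_mkord /=.
by apply: eq_bigr => j _; rewrite card_ord.
Qed.

(** The ranks are distinct, lie below the product of the dimensions and are as many as that product,
    so they fill the interval; sorted lists that are permutations of each other agree. *)
Lemma sorted_colmajor_rank n d :
  [seq colmajor_rank i | i <- sort (relpre (@colmajor_rank n d) leq)
                                   (enum (multi_index n d))] =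
  iota 0 (\prod_(0 <= k < d) n k).
Proof.
apply: (sorted_eq leq_trans anti_leq).
- by rewrite sorted_map sort_sorted// => i k; apply: leq_total.
- exact: iota_sorted.
have U : uniq [seq colmajor_rank i | i <- sort (relpre (@colmajor_rank n d) leq)
                                   (enum (multi_index n d))].
  by rewrite map_inj_uniq ?sort_uniq ?enum_uniq//; apply: colmajor_rank_inj.
apply: uniq_perm => //; first exact: iota_uniq.
apply: (uniq_min_size U _ _).2.
  move=> _ /mapP[i _ ->]; rewrite mem_iota /= add0n colmajor_rankE.
  by apply: mixed_value_lt => j; apply: digit_lt.
by rewrite size_iota size_map size_sort -cardE card_multi_index.
Qed.

Lemma sum_tensor_entries (R : realType) n d (A : tensor R n d)
    (F : R -> nat -> R) :
  \sum_(i : multi_index n d) F (A i) (colmajor_rank i) =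
  \sum_(r < \prod_(0 <= k < d) n k) F (tensor_entries A)`_r r.
Proof.
have sE := @sorted_colmajor_rank n d.
rewrite /tensor_entries; set s := sort _ _ in sE *.
rewrite -big_enum /=.
have ps : perm_eq s (enum (multi_index n d)) by rewrite perm_sort.
rewrite -(perm_big _ ps) /= {ps}.
rewrite -(big_mkord xpredT (fun r => F [seq A i | i <- s]`_r r)).
have sz : size s = (\prod_(0 <= k < d) n k)%N.
  by rewrite -(size_map (@colmajor_rank n d)) sE size_iota.
(* A multi-index is needed as default for [nth]; if there is none, both sums are empty. *)
rewrite -sz; case: s sE sz => [|i0 s] sE sz; first by rewrite big_nil big_geq.
rewrite (big_nth i0); apply: eq_big_nat => r rs.
rewrite (nth_map i0)//; congr F.
by rewrite -(nth_map i0 0%N)// sE nth_iota -?sz.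
Qed.

(** * The unfolding of the tensor *)

Lemma norm_unfolding (R : realType) n d (A : tensor R n d) :
  (0 < d)%N -> mx_norm2 (unfolding A) = tensor_norm A.
Proof.
move=> d0; have S0 : 0 <= \sum_(i : multi_index n d) A i ^+ 2.
  by apply: sumr_ge0 => i _; rewrite sqr_ge0.
apply/eqP; rewrite -(@eqrXn2 _ 2) ?mx_norm2_ge0 ?sqrtr_ge0//; apply/eqP.
rewrite sqr_norm_reshape sqr_sqrtr//.
by rewrite (sum_tensor_entries A (fun a _ => a ^+ 2)) [in RHS]big_ltn.
Qed.

(** Summed by rank, each entry is weighted by the digits of its position; the lowest digit is then
    contracted. *)
Lemma tensor_form_unfolding (R : realType) n d (A : tensor R n d)
    (x : forall j : nat, 'cV[R]_(n j)) : (0 < d)%N ->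
  tensor_form A x =
  \sum_(k < \prod_(1 <= k < d) n k) ((unfolding A)^T *m x 0%N) k ord0 *
    weight n (fun j => nth 0 (vector_entries (x j))) d.-1 1 k.
Proof.
case: d A => // d A _; set X := fun j => nth 0 _.
rewrite -(reshape_contract _ _ _ (fun k => weight n X d 1 k)) -[(n 0%N * _)%N]big_ltn//.
rewrite -(sum_tensor_entries A (fun a r => a * weight n X d.+1 0 r)).
apply: eq_bigr => i _; congr (_ * _).
rewrite colmajor_rankE weight_mixed_value; last exact: digit_lt.
rewrite big_mkord; apply: eq_bigr => j _.
by rewrite digitE /X vector_entriesE.
Qed.

Lemma tensor_form_le_lambda_max (R : realType) n d (A : tensor R n d)
    (x : forall j : nat, 'cV[R]_(n j)) : (0 < d)%N ->
  (forall j, (j < d)%N -> mx_norm2 (x j) = 1) ->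
  tensor_form A x <= lambda_max (unfolding A).
Proof.
move=> d0 x1; rewrite tensor_form_unfolding//.
set X := fun j => nth 0 _.
(* [z] is the vectorised outer product of [x 1], ..., [x (d-1)], a unit vector, and the form equals
   [<x 0, A_1 z>]. *)
pose z : 'cV[R]_(\prod_(1 <= k < d) n k) := \col_k weight n X d.-1 1 k.
have -> : \sum_(k < \prod_(1 <= k < d) n k) ((unfolding A)^T *m x 0%N) k ord0 *
            weight n X d.-1 1 k = dot ((unfolding A)^T *m x 0%N) z.
  by rewrite dotvE; apply: eq_bigr => k _; rewrite [z _ _]mxE.
have z1 : mx_norm2 z = 1.
  apply/eqP; rewrite -(@eqrXn2 _ 2) ?mx_norm2_ge0// sqr_mx_norm2 expr1n dotvE.
  have := sum_weight_sqr n X d.-1 1; rewrite add1n prednK// => wS.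
  rewrite (eq_bigr (fun k : 'I__ => weight n X d.-1 1 k ^+ 2)); last first.
    by move=> k _; rewrite mxE.
  rewrite wS big_nat big1// => j /andP[_ jd].
  have := x1 j jd => /(congr1 (fun t => t ^+ 2)).
  rewrite expr1n sqr_mx_norm2 dotvE => <-; apply/eq_bigr => k _.
  by rewrite /X vector_entriesE expr2.
rewrite dot_mull; apply: le_trans (cauchy_schwarz _ _) _.
by rewrite x1// mul1r mx_norm2_mulmx_le_lambda_max.
Qed.

(** * Runs of the algorithm *)

Lemma sqrt_prod (R : rcfType) d (F : nat -> R) : (forall i, 0 <= F i) ->
  Num.sqrt (\prod_(j < d) F j) = \prod_(j < d) Num.sqrt (F j).
Proof.
move=> F0; elim: d => [|d IH]; first by rewrite !big_ord0 sqrtr1.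
by rewrite !big_ord_recr /= sqrtrM ?IH// prodr_ge0.
Qed.

Lemma tensor_norm_gt0 (R : realType) n d (A : tensor R n d) :
  (0 < tensor_norm A) = (A != 0).
Proof.
have nn i : 0 <= A i ^+ 2 by rewrite sqr_ge0.
rewrite sqrtr_gt0 lt_neqAle sumr_ge0// andbT eq_sym psumr_eq0//; congr (~~ _).
apply/allP/eqP => [H|-> i _]; last by rewrite ffunE expr0n /= eqxx.
apply/ffunP => i; rewrite ffunE.
by have := H i (mem_index_enum _); rewrite /= sqrf_eq0 => /eqP.
Qed.

(** Invariant: once modes 0 to [j] are contracted, the remaining modes enter through [weight]
    only. *)
Lemma run_form (R : realType) n d (A : tensor R n d) w
    (x : forall j : nat, 'cV[R]_(n j)) M j :
  algorithm_V2_run A w M x -> (j.+1 < d)%N ->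
  tensor_form A x =
  \sum_(k < \prod_(j.+1 <= k < d) n k) ((M j)^T *m x j) k ord0 *
    weight n (fun j => nth 0 (vector_entries (x j))) (d - j.+1) j.+1 k.
Proof.
case=> M0 Mstep _ _; set X := fun j => nth 0 _.
elim: j => [|j IH] jd; first by rewrite tensor_form_unfolding 1?ltnW// M0 subn1.
(* Writing [d - j.+1] as a successor exposes the digit of mode [j.+1]. *)
rewrite IH 1?ltnW// Mstep// -(subnSK (ltnW jd)).
rewrite -(reshape_contract _ _ _ (weight n X (d - j.+2) j.+2)).
rewrite -[(n j.+1 * _)%N](@big_ltn _ _ _ j.+1) 1?ltnW//.
by apply: eq_bigr => k _; rewrite vector_entriesE.
Qed.

Lemma run_form_last (R : realType) n d (A : tensor R n d.+2) w
    (x : forall j : nat, 'cV[R]_(n j)) M :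
  algorithm_V2_run A w M x ->
  tensor_form A x =
  dot (reshape_mx (n d.+1) 1 (vector_entries ((M d)^T *m x d))) (x d.+1).
Proof.
move=> run; rewrite (run_form run (ltnSn d.+1)); set X := fun j => nth 0 _.
set v := _ *m x d; have pE : \prod_(d.+1 <= k < d.+2) n k = (n d.+1 * 1)%N.
  by rewrite big_nat1 muln1.
rewrite subSn// subnn.
(* One digit is left; contracting it leaves a single entry of weight 1. *)
transitivity (\sum_(k < 1) ((reshape_mx (n d.+1) 1 (vector_entries v))^T
                              *m x d.+1) k ord0 * (1 : R)).
  rewrite -(reshape_contract _ _ _ (fun=> 1)) -pE.
  by apply: eq_bigr => k _; rewrite vector_entriesE.
by rewrite big_ord1 mulr1 /dot /mxtrace big_ord1.
Qed.

Lemma run_norm (R : realType) n d (A : tensor R n d) w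
    (x : forall j : nat, 'cV[R]_(n j)) M j :
  A != 0 -> (forall j, (j < d)%N -> 0 <= w j < 1 / Num.sqrt (n j)%:R) ->
  algorithm_V2_run A w M x -> (j.+1 < d)%N ->
  (\prod_(i < j.+1) (mode_factor (w i) (n i) / Num.sqrt (n i)%:R)) *
    tensor_norm A <= mx_norm2 ((M j)^T *m x j).
Proof.
move=> A0 hw [M0 Mstep Mx _].
pose q i := mode_factor (w i) (n i) / Num.sqrt (n i)%:R.
have q0 i : (i < d)%N -> 0 < q i.
  by move=> id; rewrite divr_gt0 ?mode_factor_gt0 ?(sqrt_size_gt0 (hw i id)) ?hw.
have Q0 m : (m <= d)%N -> 0 < \prod_(i < m) q i.
  by move=> md; apply: prodr_gt0 => i _; apply: q0; apply: leq_trans md.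
have An : 0 < tensor_norm A by rewrite tensor_norm_gt0.
have step i : (i.+1 < d)%N -> (\prod_(k < i) q k) * tensor_norm A <= mx_norm2 (M i) ->
    (\prod_(k < i.+1) q k) * tensor_norm A <= mx_norm2 ((M i)^T *m x i).
  move=> id le_i; have [k [kmax kx]] := Mx i id.
  (* The positive lower bound keeps every [M i] nonzero, so its longest row can be normalized
     against. *)
  have Mi0 : M i != 0.
    rewrite -mx_norm2_gt0; apply: lt_le_trans le_i.
    by rewrite mulr_gt0 ?Q0// ltnW// ltnW.
  apply: le_trans (max_row_step Mi0 kmax (hw i (ltnW id)) kx).
  rewrite big_ord_recr /= mulrAC mulrC ler_wpM2l//.
  exact/ltW/q0/ltnW.
elim: j => [|j IH] jd; apply: step => //.
  by rewrite big_ord0 mul1r M0 norm_unfolding// ltnW.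
rewrite Mstep// norm_reshape_vector ?IH 1?ltnW//.
by rewrite big_ltn 1?ltnW.
Qed.

(** * The chain of inequalities *)

Unset Implicit Arguments.

Theorem theorem3p2 (R : realType) (d : nat) (n : nat -> nat)
    (A : tensor R n d) (w : nat -> R) (x : forall j : nat, 'cV[R]_(n j))
    (hd : (3 <= d)%N) (hA : A != 0)
    (hw : forall j : nat, (j < d)%N -> 0 <= w j < 1 / Num.sqrt (n j)%:R)
    (hx : algorithm_V2_output A w x)
    (xt : forall j : nat, 'cV[R]_(n j))
    (hxt : forall j : nat, (j < d)%N -> mx_norm2 (xt j) = 1) :
  let C : R :=
    (\prod_(j < d) (1 - w j * Num.sqrt (n j)%:R + w j))
      / Num.sqrt (\prod_(j < d.-1) (n j)%:R) in
  [/\ tensor_form A x >= C * tensor_norm A,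
      C * tensor_norm A >= C * lambda_max (unfolding A)
    & C * lambda_max (unfolding A) >= C * tensor_form A xt].
Proof.
case: d A hd hA hw hx hxt => [|[|d]] A // hd hA hw [M run] hxt C.
have factor0 j : (j < d.+2)%N -> 0 < mode_factor (w j) (n j).
  by move=> jd; apply: mode_factor_gt0; apply: hw.
have C0 : 0 <= C.
  rewrite divr_ge0 ?sqrtr_ge0// prodr_ge0// => j _.
  exact/ltW/factor0.
(* Read on the unfolding, the last two inequalities bound [lambda_max] above and below, scaled by
   [C >= 0]. *)
rewrite -(norm_unfolding A (ltn0Sn _)); split; last first.
- by rewrite ler_wpM2l// tensor_form_le_lambda_max.
- by rewrite ler_wpM2l// lambda_max_le_norm.
rewrite norm_unfolding//.
have := run_norm hA hw run (ltnSn _).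
(* The square root in [C] splits over the modes before the last and pairs with their factors. *)
have -> : C = mode_factor (w d.+1) (n d.+1) *
    \prod_(i < d.+1) (mode_factor (w i) (n i) / Num.sqrt (n i)%:R).
  rewrite /C (@sqrt_prod _ _ (fun i => (n i)%:R))//= big_split /= prodfV.
  by rewrite big_ord_recr /= mulrAC mulrC.
rewrite (run_form_last run).
set v := _ *m _; set u := reshape_mx _ _ _.
have <- : mx_norm2 u = mx_norm2 v.
  by rewrite norm_reshape_vector// big_nat1 muln1.
move=> u_ge; rewrite -mulrA.
apply: le_trans (_ : mode_factor (w d.+1) (n d.+1) * mx_norm2 u <= _).
  by rewrite ler_wpM2l//; exact/ltW/factor0.
apply: sparsification_normalized_dot; last 2 first.
- exact: hw.
- by case: run => _ _ _; apply.
(* The norm bound also shows that the vector normalized at the last mode is nonzero. *)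
rewrite -mx_norm2_gt0; apply: lt_le_trans u_ge.
rewrite mulr_gt0 ?tensor_norm_gt0// prodr_gt0// => i _.
have id : (i < d.+2)%N by rewrite leqW.
by rewrite divr_gt0 ?factor0// (sqrt_size_gt0 (hw i id)).
Qed.
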